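(* Let $\mathcal{S}$ be a finite dimensional real operator system with faithful state $\varphi$. Then $(\mathcal{S}^d,\varphi)$ is a real operator system, $((\mathcal{S}_c)^d,\varphi_c)$ is a complex operator system, and $$(\mathcal{S}_c)^d\cong(\mathcal{S}^d)_c$$ unitally complete order isomorphically.
   Context: A real operator system is a unital selfadjoint real subspace of $B(H)$, $H$ a real Hilbert space, with matrix cones $M_n(\mathcal{S})^+$; equivalently (abstractly) a real $*$-vector space with a proper matrix ordering and an archimedean matrix order unit. Its complexification is $\mathcal{S}_c=\mathcal{S}+i\mathcal{S}$ with $(x+iy)^*=x^*-iy^*$, the same unit, and $M_n(\mathcal{S}_c)^+=\{x+iy:x=x^*,\,y=-y^*\in M_n(\mathcal{S}),\ \begin{bmatrix} x & -y \\ y & x \end{bmatrix}\in M_{2n}(\mathcal{S})^+\}$. A (real) state is a unital selfadjoint positive functional $\varphi:\mathcal{S}\to\mathbb{R}$ ($\varphi(x^* )=\varphi(x)$); it is faithful if $x\in\mathcal{S}^+$ and $\varphi(x)=0$ imply $x=0$. Its complexification is $\varphi_c(x+iy)=\varphi(x)+i\varphi(y)$. The dual $\mathcal{S}^d$ is the dual vector space (real functionals in the real case, complex functionals in the complex case) with involution $\psi^*(x)=\overline{\psi(x^* )}$ and matrix cones $M_n(\mathcal{S}^d)^+=\{[\psi_{ij}]: x\mapsto[\psi_{ij}(x)]\ \text{is completely positive from}\ \mathcal{S}\ \text{to}\ M_n\}$. The pair $(\mathcal{S}^d,\varphi)$ denotes $\mathcal{S}^d$ with $\varphi$ taken as the unit.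 *)

(* Defs.v *)
From HB Require Import structures.
From mathcomp Require Import all_boot all_order all_algebra.
From mathcomp Require Import ssrAC reals complex.

Set Implicit Arguments.
Unset Strict Implicit.
Unset Printing Implicit Defensive.

Import Order.TTheory GRing.Theory Num.Theory.
Import VectorInternalTheory.
Local Open Scope ring_scope.

(* Operator systems are taken in their abstract form: a *-vector space with a
   proper matrix ordering and an archimedean matrix order unit.
   Real and complex operator systems are treated uniformly over a number field
   K with a chosen conjugation cj : K -> K; the two cases of interest are
   K = R with cj = idfun and K = R[i] with cj = conjc.  In both cases 0 <= r
   in K means that r is a nonnegative real number. *)

Record opsys_data (K : numFieldType) (V : lmodType K) := OpsysData {
  os_star : V -> V;
  os_cone : forall n : nat, 'M[V]_n -> Prop;
  os_unit : V
}.

Section OperatorSystems.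
Variables (K : numFieldType) (cj : K -> K).

Definition mx_star (V : Type) (st : V -> V) m n (X : 'M[V]_(m, n)) :
    'M[V]_(n, m) :=
  map_mx st X^T.

(* A^* X A for a matrix X of vectors and a matrix A of scalars. *)
Definition mx_compress (V : lmodType K) n m (A : 'M[K]_(n, m)) (X : 'M[V]_n) :
    'M[V]_m :=
  \matrix_(i, j) \sum_k \sum_l (cj (A k i) * A l j) *: X k l.

Record operator_system (V : lmodType K) (X : opsys_data V) : Prop := {
  star_linear : forall (a : K) (x y : V),
    os_star X (a *: x + y) = cj a *: os_star X x + os_star X y;
  star_invol : involutive (os_star X);
  cone_star : forall n (x : 'M[V]_n), os_cone X x -> mx_star (os_star X) x = x;
  cone_add : forall n (x y : 'M[V]_n),
    os_cone X x -> os_cone X y -> os_cone X (x + y);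
  cone_scale : forall n (r : K) (x : 'M[V]_n),
    0 <= r -> os_cone X x -> os_cone X (map_mx (GRing.scale r) x);
  cone_compress : forall n m (A : 'M[K]_(n, m)) (x : 'M[V]_n),
    os_cone X x -> os_cone X (mx_compress A x);
  cone_proper : forall n (x : 'M[V]_n),
    os_cone X x -> os_cone X (- x) -> x = 0;
  unit_star : os_star X (os_unit X) = os_unit X;
  unit_order : forall n (x : 'M[V]_n), mx_star (os_star X) x = x ->
    exists2 r : K, 0 < r & os_cone X ((r *: os_unit X)%:M + x);
  unit_archimedean : forall n (x : 'M[V]_n), mx_star (os_star X) x = x ->
    (forall r : K, 0 < r -> os_cone X ((r *: os_unit X)%:M + x)) ->
    os_cone X x
}.

(* Between operator systems this forces f to be *-preserving, also over the
   reals, because all matrix cones consist of selfadjoint matrices. *)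
Definition completely_positive (V W : lmodType K)
    (X : opsys_data V) (Y : opsys_data W) (f : V -> W) : Prop :=
  forall n (x : 'M[V]_n), os_cone X x -> os_cone Y (map_mx f x).

Definition psd n (A : 'M[K]_n) : Prop :=
  mx_star cj A = A /\
  forall v : 'cV[K]_n, 0 <= (mx_star cj v *m A *m v) 0 0.

(* The operator system M_n, where M_k(M_n) is identified with M_(kn). *)
Definition matrix_opsys n : opsys_data 'M[K]_n :=
  {| os_star := @mx_star K cj n n;
     os_cone := fun k (x : 'M['M[K]_n]_k) =>
       psd (\mxblock_(i < k, j < k) x i j);
     os_unit := 1%:M |}.

(* [linfun] only produces the intended functional when its argument is linear;
   see [dual_starE] below. *)
Definition dual_star (V : vectType K) (X : opsys_data V)
    (psi : 'Hom(V, K^o)) : 'Hom(V, K^o) :=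
  linfun (fun x : V => cj (psi (os_star X x)) : K^o).

Definition dual_opsys (V : vectType K) (X : opsys_data V)
    (phi : 'Hom(V, K^o)) : opsys_data 'Hom(V, K^o) :=
  {| os_star := dual_star X;
     os_cone := fun n (psi : 'M['Hom(V, K^o)]_n) =>
       completely_positive X (matrix_opsys n)
         (fun x : V => \matrix_(i, j) (psi i j x : K));
     os_unit := phi |}.

Definition unital_complete_order_iso (V W : vectType K)
    (X : opsys_data V) (Y : opsys_data W) : Prop :=
  exists (f : 'Hom(V, W)) (g : 'Hom(W, V)),
    [/\ cancel f g, cancel g f, f (os_unit X) = os_unit Y,
        completely_positive X Y f & completely_positive Y X g].

End OperatorSystems.

Definition real_operator_system (R : realType) (V : lmodType R)
    (X : opsys_data V) : Prop :=
  operator_system idfun X.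

Definition complex_operator_system (R : realType) (V : lmodType R[i])
    (X : opsys_data V) : Prop :=
  operator_system (@conjc R) X.

Record faithful_state (R : realType) (V : vectType R) (X : opsys_data V)
    (phi : 'Hom(V, R^o)) : Prop := {
  state_unital : phi (os_unit X) = 1;
  state_selfadjoint : forall x : V, phi (os_star X x) = phi x;
  (* x%:M is the 1 x 1 matrix with entry x *)
  state_positive : forall x : V, @os_cone _ _ X 1 x%:M -> 0 <= (phi x : R);
  state_faithful : forall x : V, @os_cone _ _ X 1 x%:M -> phi x = 0 -> x = 0
}.

(* The complexification of a real vector space: Cplx x y stands for x + i y. *)
Record cplx (V : Type) := Cplx { cre : V; cim : V }.

Section Complexification.
Variables (R : realType) (V : vectType R).
Implicit Types z w : cplx V.

Definition pair_of_cplx z := (cre z, cim z).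
Definition cplx_of_pair (p : V * V) := Cplx p.1 p.2.
Lemma pair_of_cplxK : cancel pair_of_cplx cplx_of_pair.
Proof. by case. Qed.
HB.instance Definition _ := Choice.copy (cplx V) (can_type pair_of_cplxK).

Definition cplx_add z w := Cplx (cre z + cre w) (cim z + cim w).
Definition cplx_opp z := Cplx (- cre z) (- cim z).
Fact cplx_addA : associative cplx_add.
Proof. by move=> z w t; rewrite /cplx_add /= !addrA. Qed.
Fact cplx_addC : commutative cplx_add.
Proof. by move=> z w; congr Cplx; rewrite addrC. Qed.
Fact cplx_add0 : left_id (Cplx 0 0) cplx_add.
Proof. by case=> x y; rewrite /cplx_add /= !add0r. Qed.
Fact cplx_addN : left_inverse (Cplx 0 0) cplx_opp cplx_add.
Proof. by move=> z; rewrite /cplx_add /= !addNr. Qed.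
HB.instance Definition _ :=
  GRing.isZmodule.Build (cplx V) cplx_addA cplx_addC cplx_add0 cplx_addN.

Definition cplx_scale (a : R[i]) z :=
  Cplx (complex.Re a *: cre z - complex.Im a *: cim z)
       (complex.Re a *: cim z + complex.Im a *: cre z).
Fact cplx_scaleA (a b : R[i]) z :
  cplx_scale a (cplx_scale b z) = cplx_scale (a * b) z.
Proof.
case: a b z => [a a'] [b b'] [x y]; rewrite /cplx_scale /=; congr Cplx.
  rewrite !scalerBr !scalerDr !scalerBl !scalerDl !scalerA !opprD.
  by rewrite (AC (2*2) ((1*4)*(2*3))).
rewrite !scalerBr !scalerDr !scalerBl !scalerDl !scalerA.
by rewrite (AC (2*2) ((1*4)*(2*3))).
Qed.
Fact cplx_scale1 : left_id 1 cplx_scale.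
Proof.
by case=> x y; rewrite /cplx_scale /= !scale1r !scale0r subr0 addr0.
Qed.
Fact cplx_scaleDr : right_distributive cplx_scale +%R.
Proof.
move=> a z w; congr Cplx; rewrite /= !scalerDr.
  by rewrite opprD addrACA.
by rewrite addrACA.
Qed.
Fact cplx_scaleDl z : {morph cplx_scale^~ z : a b / a + b}.
Proof.
case=> [a a'] [b b']; congr Cplx; rewrite /= !scalerDl.
  by rewrite opprD addrACA.
by rewrite addrACA.
Qed.
HB.instance Definition _ := GRing.Zmodule_isLmodule.Build R[i] (cplx V)
  cplx_scaleA cplx_scale1 cplx_scaleDr cplx_scaleDl.

Fact cplx_vect_iso : Vector.axiom (dim V) (cplx V).
Proof.
exists (fun z => \row_j Complex (v2r (cre z) 0 j) (v2r (cim z) 0 j)).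
  move=> [a a'] [x y] [t u]; apply/rowP=> j; rewrite !mxE /=.
  by rewrite !linearD !linearN !linearZ /= !mxE mulrN.
exists (fun r : 'rV_(dim V) => Cplx (r2v (\row_j complex.Re (r 0 j)))
                      (r2v (\row_j complex.Im (r 0 j)))).
  move=> [x y]; congr Cplx; apply: (can_inj v2rK); rewrite r2vK;
    by apply/rowP=> j; rewrite !mxE.
by move=> r; apply/rowP=> j; rewrite !mxE /= !r2vK !mxE; case: (r 0 j).
Qed.
HB.instance Definition _ :=
  Lmodule_hasFinDim.Build R[i] (cplx V) cplx_vect_iso.

Definition cplx_star (st : V -> V) z : cplx V :=
  Cplx (st (cre z)) (- st (cim z)).

Definition cplx_opsys (X : opsys_data V) : opsys_data (cplx V) :=
  {| os_star := cplx_star (os_star X);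
     os_cone := fun n (z : 'M[cplx V]_n) =>
       let x := map_mx (@cre V) z in
       let y := map_mx (@cim V) z in
       [/\ x = mx_star (os_star X) x, y = - mx_star (os_star X) y
         & os_cone X (block_mx x (- y) y x)];
     os_unit := Cplx (os_unit X) 0 |}.

(* See [cplx_functionalE]. *)
Definition cplx_functional (phi : 'Hom(V, R^o)) : 'Hom(cplx V, R[i]^o) :=
  linfun (fun z : cplx V => Complex (phi (cre z)) (phi (cim z)) : R[i]^o).

Lemma cplx_functionalE phi z :
  cplx_functional phi z = Complex (phi (cre z)) (phi (cim z)).
Proof.
set f := fun z : cplx V => Complex (phi (cre z)) (phi (cim z)) : R[i]^o.
have lin_f : linear f.
  move=> [a a'] [x y] [t u]; rewrite /f /=.
  by rewrite !linearD !linearN !linearZ /= scalerN.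
pose fl := GRing.isLinear.Build _ _ _ _ f lin_f.
pose F : {linear cplx V -> R[i]^o} := HB.pack f fl.
exact: (lfunE F z).
Qed.

End Complexification.

Section DualStar.
Variables (K : numFieldType) (cj : {rmorphism K -> K}).
Hypothesis cjK : involutive cj.

Lemma dual_starE (V : vectType K) (X : opsys_data V) psi x :
  operator_system cj X -> dual_star cj X psi x = cj (psi (os_star X x)).
Proof.
move=> sysX; set f := fun x : V => cj (psi (os_star X x)) : K^o.
have lin_f : linear f.
  move=> a y z; rewrite /f (star_linear sysX) linearD linearZ /=.
  by rewrite rmorphD rmorphM /= cjK.
pose fl := GRing.isLinear.Build _ _ _ _ f lin_f.
pose F : {linear V -> K^o} := HB.pack f fl.
exact: (lfunE F x).
Qed.

End DualStar.

(* Main.v *)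
From HB Require Import structures.
Require Import Defs.
From mathcomp Require Import all_boot all_order all_algebra.
From mathcomp Require Import boolp classical_sets reals complex ring.
From mathcomp Require Import topology normedtype derive.

(* Pairing psi in M_n(S^d) with x in M_n(S) by \sum_(i, j) psi_ij(x_ij)
   identifies M_n(S^d)^+ with the selfadjoint elements of the dual cone of
   M_n(S)^+: testing a matrix of functionals on x in M_k(S)^+ at a vector
   amounts to pairing it with some A^* x A.  With this description all the
   axioms of an operator system are immediate for S^d, except that phi is an
   order unit.  There the trace x |-> \sum_i phi(x_ii) is strictly positive on
   the nonzero elements of M_n(S)^+, and M_n(S)^+ is closed because the unit is
   an archimedean interior point, so by compactness of the unit sphere a
   multiple of the trace dominates any functional.
   On the complex side, psi in M_n((S_c)^d) is sent to its real and imaginary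
   parts restricted to S.  Writing x as [[a, b], [c, d]], the pairing of the
   2n x 2n realification of psi with x is the real part of the pairing of psi
   with (a + d) + i (b - c), and x |-> (a + d) + i (b - c) maps M_2n(S)^+ onto
   M_n(S_c)^+.  The cones therefore agree, and (S_c)^d inherits its order unit
   from (S^d)_c. *)

Set Implicit Arguments.
Unset Strict Implicit.
Unset Printing Implicit Defensive.

Import Order.TTheory GRing.Theory Num.Theory.
Import VectorInternalTheory.

Local Open Scope ring_scope.

(** * Duals over a field with conjugation *)

Section Pairing.
Variables (K : numFieldType) (V : vectType K).

Definition pairing n (psi : 'M['Hom(V, K^o)]_n) (x : 'M[V]_n) : K :=
  \sum_i \sum_j (psi i j (x i j) : K).

Lemma pairingDl n (psi chi : 'M['Hom(V, K^o)]_n) (x : 'M[V]_n) :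
  pairing (psi + chi) x = pairing psi x + pairing chi x.
Proof.
rewrite /pairing -big_split; apply: eq_bigr => i _; rewrite -big_split.
by apply: eq_bigr => j _; rewrite mxE lfunE.
Qed.

Lemma pairingDr n (psi : 'M['Hom(V, K^o)]_n) (x y : 'M[V]_n) :
  pairing psi (x + y) = pairing psi x + pairing psi y.
Proof.
rewrite /pairing -big_split; apply: eq_bigr => i _; rewrite -big_split.
by apply: eq_bigr => j _; rewrite mxE linearD.
Qed.

Lemma pairingNl n (psi : 'M['Hom(V, K^o)]_n) (x : 'M[V]_n) :
  pairing (- psi) x = - pairing psi x.
Proof.
rewrite /pairing -sumrN; apply: eq_bigr => i _; rewrite -sumrN.
by apply: eq_bigr => j _; rewrite mxE opp_lfunE.
Qed.

Lemma pairingZl n (psi : 'M['Hom(V, K^o)]_n) (x : 'M[V]_n) r :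
  pairing (map_mx (GRing.scale r) psi) x = r * pairing psi x.
Proof.
rewrite /pairing mulr_sumr; apply: eq_bigr => i _; rewrite mulr_sumr.
by apply: eq_bigr => j _; rewrite mxE scale_lfunE.
Qed.

Lemma pairing_scalar n (phi : 'Hom(V, K^o)) (x : 'M[V]_n) :
  pairing phi%:M x = \sum_i (phi (x i i) : K).
Proof.
apply: eq_bigr => i _; rewrite (bigD1 i) //= big1 ?addr0 => [|j ji].
  by rewrite mxE eqxx.
by rewrite mxE eq_sym (negPf ji) mulr0n zero_lfunE.
Qed.

End Pairing.

Section Compress.
Variables (K : numFieldType) (cj : {rmorphism K -> K}).

Lemma mx_star_compress (V : lmodType K) (st : V -> V) n m (A : 'M[K]_(n, m))
    (x : 'M[V]_n) :
  involutive cj ->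
  (forall (a : K) (u v : V), st (a *: u + v) = cj a *: st u + st v) ->
  mx_star st (mx_compress cj A x) = mx_compress cj A (mx_star st x).
Proof.
move=> cjK st_lin.
have stD u v : st (u + v) = st u + st v.
  by rewrite -[u]scale1r st_lin rmorph1 !scale1r.
have st0 : st 0 = 0 by apply: (addrI (st 0)); rewrite -stD !addr0.
have stZ a u : st (a *: u) = cj a *: st u.
  by rewrite -[a *: u]addr0 st_lin st0 addr0.
have st_sum k (F : 'I_k -> V) : st (\sum_i F i) = \sum_i st (F i).
  exact: big_morph.
apply/matrixP=> i j; rewrite !mxE st_sum.
under eq_bigr do rewrite st_sum; rewrite exchange_big.
apply: eq_bigr => k _; apply: eq_bigr => l _.
by rewrite !mxE stZ rmorphM /= cjK mulrC.
Qed.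

(** A matrix with one nonzero entry per column relabels and rescales entries. This covers passing to
    submatrices, sign changes by diag(1, -1) and block swaps. *)
Lemma mx_compress_reindex (V : lmodType K) n m (h : 'I_m -> 'I_n)
    (s : 'I_m -> K) (x : 'M[V]_n) :
  mx_compress cj (\matrix_(k, i) (s i *+ (k == h i))) x =
  \matrix_(i, j) ((cj (s i) * s j) *: x (h i) (h j)).
Proof.
apply/matrixP=> i j; rewrite !mxE (bigD1 (h i)) //= [X in _ + X]big1 => [|k kh].
  rewrite addr0 (bigD1 (h j)) //= big1 ?addr0 => [|l lh].
    by rewrite !mxE !eqxx !mulr1n.
  by rewrite !mxE eqxx (negPf lh) mulr0n mulr0 scale0r.
by apply: big1 => l _; rewrite !mxE (negPf kh) mulr0n rmorph0 mul0r scale0r.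
Qed.

(** The pairing is bilinear, not sesquilinear, so compression by [A] moves across it as compression
    by the plain transpose, without conjugation. *)
Lemma pairing_compress (V : vectType K) n m (A : 'M[K]_(n, m))
    (psi : 'M['Hom(V, K^o)]_n) (x : 'M[V]_m) :
  pairing (mx_compress cj A psi) x = pairing psi (mx_compress cj A^T x).
Proof.
transitivity (\sum_i \sum_j \sum_k \sum_l
   (cj (A k i) * A l j * psi k l (x i j) : K)).
  apply: eq_bigr => i _; apply: eq_bigr => j _; rewrite mxE sum_lfunE.
  by apply: eq_bigr => k _; rewrite sum_lfunE; apply: eq_bigr => l _;
     rewrite scale_lfunE.
under eq_bigr => i _ do rewrite exchange_big /=.
rewrite exchange_big; apply: eq_bigr => k _.
under eq_bigr => i _ do rewrite exchange_big /=.
rewrite exchange_big; apply: eq_bigr => l _.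
rewrite mxE linear_sum; apply: eq_bigr => i _; rewrite linear_sum.
by apply: eq_bigr => j _; rewrite linearZ /= !mxE.
Qed.

End Compress.

Section Dual.
Variables (K : numFieldType) (cj : {rmorphism K -> K}).
Hypothesis cjK : involutive cj.
Hypothesis cj_ge0 : forall r : K, 0 <= r -> cj r = r.
Variables (V : vectType K) (X : opsys_data V).
Hypothesis sysX : operator_system cj X.
Implicit Types phi : 'Hom(V, K^o).

Lemma os_starD u v : os_star X (u + v) = os_star X u + os_star X v.
Proof.
by have := star_linear sysX 1 u v; rewrite rmorph1 !scale1r.
Qed.

Lemma os_star0 : os_star X 0 = 0.
Proof. by apply: (addrI (os_star X 0)); rewrite -os_starD !addr0. Qed.

Lemma os_starZ a u : os_star X (a *: u) = cj a *: os_star X u.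
Proof.
by rewrite -[a *: u]addr0 (star_linear sysX) os_star0 addr0.
Qed.

Lemma cone_unit n (r : K) : 0 < r -> os_cone X ((r *: os_unit X)%:M : 'M_n).
Proof.
move=> r0; have [|s s0] := @unit_order _ _ _ _ sysX n 0.
  by apply/matrixP=> i j; rewrite !mxE os_star0.
rewrite addr0 => cs.
have rs0 : 0 <= r / s by rewrite divr_ge0 ?ltW.
have := cone_scale sysX rs0 cs; congr os_cone; apply/matrixP=> i j.
by rewrite !mxE -scalerMnr scalerA divfK // gt_eqF.
Qed.

Lemma cone_reindex n m (h : 'I_m -> 'I_n) (s : 'I_m -> K) (x : 'M[V]_n) :
  os_cone X x ->
  os_cone X (\matrix_(i, j) ((cj (s i) * s j) *: x (h i) (h j))).
Proof. by move=> cx; rewrite -mx_compress_reindex; exact: cone_compress. Qed.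

Lemma dual_starP psi x : dual_star cj X psi x = cj (psi (os_star X x)).
Proof. exact: dual_starE. Qed.

Lemma dual_star_linear (a : K) (psi chi : 'Hom(V, K^o)) :
  dual_star cj X (a *: psi + chi) =
  cj a *: dual_star cj X psi + dual_star cj X chi.
Proof.
apply/lfunP=> x; rewrite add_lfunE scale_lfunE !dual_starP.
by rewrite add_lfunE scale_lfunE rmorphD rmorphM.
Qed.

Lemma dual_starK : involutive (dual_star cj X).
Proof.
by move=> psi; apply/lfunP=> x; rewrite !dual_starP cjK (star_invol sysX).
Qed.

(** For selfadjoint [psi] and [x] this makes the pairing a fixed point of [cj], hence real in the
    complex case. *)
Lemma cj_pairing n (psi : 'M['Hom(V, K^o)]_n) (x : 'M[V]_n) :
  cj (pairing psi x) =
  pairing (mx_star (dual_star cj X) psi) (mx_star (os_star X) x).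
Proof.
rewrite /pairing rmorph_sum /= exchange_big; apply: eq_bigr => i _ /=.
rewrite rmorph_sum /=; apply: eq_bigr => j _.
by rewrite !mxE dual_starP (star_invol sysX).
Qed.

Lemma mx_star_mxblock k n (B : 'I_k -> 'I_k -> 'M[K]_n) :
  mx_star cj (\mxblock_(p < k, q < k) B p q) =
  \mxblock_(p < k, q < k) mx_star cj (B q p).
Proof. by apply/matrixP=> i j; rewrite !mxE. Qed.

Lemma mxblock_form k n (B : 'I_k -> 'I_k -> 'M[K]_n) (v : 'I_k -> 'cV[K]_n) :
  (mx_star cj (\mxcol_p v p) *m \mxblock_(p < k, q < k) B p q *m \mxcol_q v q)
    0 0 =
  \sum_p \sum_q \sum_i \sum_j (cj (v p i 0) * v q j 0 * B p q i j).
Proof.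
have -> : mx_star cj (\mxcol_p v p) = \mxrow_p mx_star cj (v p).
  by apply/matrixP=> i j; rewrite !mxE.
rewrite mul_mxrow_mxblock mul_mxrow_mxcol summxE exchange_big /=.
apply: eq_bigr => q _; rewrite mulmx_suml summxE; apply: eq_bigr => p _.
rewrite mxE exchange_big; apply: eq_bigr => j _ /=.
rewrite mxE mulr_suml; apply: eq_bigr => i _.
by rewrite !mxE mulrAC.
Qed.

(** Complete positivity into M_n quantifies over matrices of every size k; here it is reduced to one
    inequality at size n. *)
Lemma dual_coneP phi n (psi : 'M['Hom(V, K^o)]_n) :
  os_cone (dual_opsys cj X phi) psi <->
  mx_star (dual_star cj X) psi = psi /\
  (forall x : 'M[V]_n, os_cone X x -> 0 <= pairing psi x).
Proof.
split=> [cp | [sa pos] k x cx].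
  split=> [|x cx].
    (* Positivity on r 1 + [[0, x], [x^*, 0]] forces selfadjointness; over the
       reals this cannot be read off the positive elements of V itself. *)
    apply/matrixP=> i j; apply/lfunP=> x; rewrite !mxE dual_starP.
    pose Y : 'M[V]_2 := \matrix_(p, q)
      (if (p == ord0) && (q == lift ord0 ord0) then x else
       if (p == lift ord0 ord0) && (q == ord0) then os_star X x else 0).
    have saY : mx_star (os_star X) Y = Y.
      apply/matrixP=> p q; rewrite !mxE.
      case: (unliftP ord0 p) => [p'|] ->; case: (unliftP ord0 q) => [q'|] ->;
        by rewrite ?(ord1 p') ?(ord1 q') /= ?os_star0 ?(star_invol sysX).
    have [r r0 cY] := unit_order sysX saY.
    have [] := cp _ _ cY; rewrite mx_star_mxblock.
    move=> /eq_mxblockP /(_ ord0 (lift ord0 ord0)) /matrixP /(_ i j) + _.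
    by rewrite !mxE /= mulr0n !add0r.
  (* The pairing is the value at the test vector \sum_p e_p (x) e_p. *)
  have [_ /(_ (\mxcol_(p < n) delta_mx p 0))] := cp _ _ cx.
  rewrite mxblock_form /=; congr (0 <= _).
  apply: eq_bigr => p _; apply: eq_bigr => q _.
  rewrite (bigD1 p) //= [X in _ + X]big1 => [|i ip].
    rewrite addr0 (bigD1 q) //= big1 => [|j jq].
      by rewrite !mxE !eqxx rmorph1 !mul1r addr0.
    by rewrite !mxE (negPf jq) mulr0 mul0r.
  by apply: big1 => j _; rewrite !mxE (negPf ip) rmorph0 !mul0r.
split.
  rewrite /= mx_star_mxblock; apply: eq_mxblock => p q; apply/matrixP=> i j.
  rewrite !mxE -{2}sa !mxE dual_starP.
  by rewrite -{1}(cone_star sysX cx) !mxE.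
move=> v; rewrite -[v]submxcolK mxblock_form.
(* The k blocks of v are the rows of the matrix A with which x is compressed. *)
have := pos _ (cone_compress sysX (\matrix_(p < k, i < n) submxcol v p i 0) cx).
congr (0 <= _).
under eq_bigr => p _ do rewrite exchange_big /=.
rewrite [RHS]exchange_big; apply: eq_bigr => i _.
under [RHS]eq_bigr => p _ do rewrite exchange_big /=.
rewrite [RHS]exchange_big; apply: eq_bigr => j _.
rewrite mxE linear_sum; apply: eq_bigr => p _; rewrite linear_sum.
by apply: eq_bigr => q _; rewrite linearZ /= !mxE.
Qed.

(** The order of [K] may be partial, so the case r = 1 is used first to see that [a] is real. If a <
    0, then b > 0, and r = - a / (2 b) gives 0 <= a / 2, a contradiction. *)
Lemma ge0_of_add_scale (a b : K) :
  0 <= b -> (forall r, 0 < r -> 0 <= r * b + a) -> 0 <= a.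
Proof.
move=> b0 ab; have := ab 1 ltr01; rewrite mul1r => ab1.
have ar : a \is Num.real.
  by rewrite -[a](addKr b) rpredD ?rpredN ?ger0_real.
rewrite real_leNgt ?real0 //; apply/negP => a0.
have b_gt0 : 0 < b.
  rewrite lt_def b0 andbT; apply/eqP=> b_eq0; move: ab1.
  by rewrite b_eq0 add0r => /(lt_le_trans a0); rewrite ltxx.
have r0 : 0 < - a / (b + b) by rewrite divr_gt0 ?oppr_gt0 ?addr_gt0.
have b2 : b + b != 0 by rewrite gt_eqF ?addr_gt0.
have := ab _ r0; have -> : - a / (b + b) * b + a = a / 2.
  by field.
by rewrite pmulr_lge0 ?invr_gt0 ?ltr0n // => /(lt_le_trans a0); rewrite ltxx.
Qed.

(** Let y carry x at (i, j) and x^* at (j, i), added together when i = j. It is selfadjoint, so r 1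
    + y is positive for some r; as [psi] kills r 1 + y and r 1, it kills y. This is the source of
    properness of the dual cones. *)
Lemma delta_cone_pairing n (psi : 'M['Hom(V, K^o)]_n) i j x :
  (forall y, os_cone X y -> pairing psi y = 0) ->
  (psi i j x : K) + psi j i (os_star X x) = 0.
Proof.
move=> psi0; pose Y p q : V := x *+ ((p == i) && (q == j)).
pose Y' p q : V := os_star X x *+ ((p == j) && (q == i)).
pose y := \matrix_(p, q) (Y p q + Y' p q).
have sa_y : mx_star (os_star X) y = y.
  apply/matrixP=> p q; rewrite !mxE os_starD addrC /Y /Y'.
  by congr (_ + _); rewrite andbC; case: (_ && _);
     rewrite ?mulr1n ?mulr0n ?os_star0 ?(star_invol sysX).
have [r r0 cy] := unit_order sysX sa_y.
have := psi0 _ cy; rewrite pairingDr psi0 ?add0r; last exact: cone_unit.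
move=> <-; rewrite /pairing.
transitivity (\sum_p \sum_q (psi p q (Y p q) : K) +
              \sum_p \sum_q (psi p q (Y' p q) : K)); last first.
  rewrite -big_split; apply: eq_bigr => p _; rewrite -big_split.
  by apply: eq_bigr => q _; rewrite mxE linearD.
have sum1 (F : 'I_n -> 'I_n -> V) p q :
    (forall k l, (k == p) && (l == q) = false -> F k l = 0) ->
    \sum_k \sum_l (psi k l (F k l) : K) = psi p q (F p q).
  move=> F0; rewrite (bigD1 p) //= [X in _ + X]big1 ?addr0 => [|k kp].
    rewrite (bigD1 q) //= big1 ?addr0 // => l lq.
    by rewrite F0 ?linear0 // (negPf lq) andbF.
  by apply: big1 => l _; rewrite F0 ?linear0 // (negPf kp).
rewrite (sum1 _ i j) ?(sum1 _ j i) /Y /Y' ?eqxx ?mulr1n // => k l ->;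
  by rewrite mulr0n.
Qed.

(** The third hypothesis isolates the order unit axiom, the only one that is not formal. It is met
    by compactness over the reals and by transport from the real dual over the complex numbers. *)
Lemma dual_operator_system phi :
  (forall x, cj (phi (os_star X x)) = phi x) ->
  (forall x, @os_cone _ _ X 1 x%:M -> 0 <= (phi x : K)) ->
  (forall n (psi : 'M['Hom(V, K^o)]_n), mx_star (dual_star cj X) psi = psi ->
    exists2 r : K, 0 < r &
      forall x, os_cone X x -> 0 <= pairing ((r *: phi)%:M + psi) x) ->
  operator_system cj (dual_opsys cj X phi).
Proof.
move=> phi_sa phi_ge0 dom.
have dsD psi chi : dual_star cj X (psi + chi) =
    dual_star cj X psi + dual_star cj X chi.
  by have := dual_star_linear 1 psi chi; rewrite rmorph1 !scale1r.
have ds0 : dual_star cj X 0 = 0.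
  by apply: (addrI (dual_star cj X 0)); rewrite -dsD !addr0.
have dsZ a psi : dual_star cj X (a *: psi) = cj a *: dual_star cj X psi.
  by rewrite -[a *: psi]addr0 dual_star_linear ds0 addr0.
have ds_phi : dual_star cj X phi = phi.
  by apply/lfunP=> x; rewrite dual_starP phi_sa.
have ds_unit n (r : K) : 0 < r ->
    mx_star (dual_star cj X) ((r *: phi)%:M : 'M_n) = (r *: phi)%:M.
  move=> r0; apply/matrixP=> i j; rewrite !mxE eq_sym.
  case: (i == j); rewrite ?mulr1n ?mulr0n ?ds0 // dsZ ds_phi cj_ge0 //.
  exact: ltW.
have dsDmx n (x y : 'M_n) : mx_star (dual_star cj X) (x + y) =
    mx_star (dual_star cj X) x + mx_star (dual_star cj X) y.
  by apply/matrixP=> i j; rewrite !mxE dsD.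
split.
- exact: dual_star_linear.
- exact: dual_starK.
- by move=> n psi /dual_coneP[].
- move=> n psi chi /dual_coneP[sp pp] /dual_coneP[sc pc]; apply/dual_coneP.
  by split=> [|x cx]; rewrite ?dsDmx ?sp ?sc // pairingDl addr_ge0 ?pp ?pc.
- move=> n r psi r0 /dual_coneP[sp pp]; apply/dual_coneP; split=> [|x cx].
    apply/matrixP=> i j; rewrite !mxE dsZ cj_ge0 //.
    by rewrite -{2}sp !mxE.
  by rewrite pairingZl mulr_ge0 ?pp.
- move=> n m A psi /dual_coneP[sp pp]; apply/dual_coneP; split=> [|x cx].
    by rewrite (mx_star_compress _ _ cjK dual_star_linear) sp.
  by rewrite pairing_compress pp //; apply: cone_compress.
- move=> n psi /dual_coneP[sp pp] /dual_coneP[_ pn].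
  have psi0 x : os_cone X x -> pairing psi x = 0.
    move=> cx; apply/eqP; rewrite eq_le pp // andbT -oppr_ge0 -pairingNl.
    exact: pn.
  apply/matrixP=> i j; apply/lfunP=> x; rewrite mxE zero_lfunE.
  (* Testing at [cj a *: x] instead of x turns both summands into a * cj a, so that their vanishing
     sum forces a = 0; at x itself only a + cj a = 0 would result. *)
  set a : K := psi i j x.
  have := @delta_cone_pairing _ psi i j (cj a *: x) psi0.
  rewrite os_starZ cjK !linearZ /=.
  have -> : psi j i (os_star X x) = cj a.
    by rewrite -[in LHS]sp !mxE dual_starP (star_invol sysX).
  move/eqP; rewrite /GRing.scale /= [cj a * _]mulrC -mulr2n mulrn_eq0 /=.
  by rewrite mulf_eq0 fmorph_eq0 orbb => /eqP.
- exact: ds_phi.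
- move=> n psi sp; have [r r0 pr] := dom _ _ sp; exists r => //.
  by apply/dual_coneP; split=> //; rewrite dsDmx sp /= ds_unit.
- move=> n psi sp pr; apply/dual_coneP; split=> // x cx.
  (* Pairing r phi 1 + psi with x gives r times the trace of x plus the pairing of [psi] with x. The
     trace is nonnegative because diagonal entries are compressions of x. *)
  apply: (@ge0_of_add_scale _ (pairing phi%:M x)) => [|r r0].
    rewrite pairing_scalar sumr_ge0 // => i _; apply: phi_ge0.
    have := cone_reindex (fun _ : 'I_1 => i) (fun=> 1) cx; congr os_cone.
    by apply/matrixP=> p q; rewrite !ord1 !mxE rmorph1 mulr1 scale1r mulr1n.
  have /dual_coneP[_ /(_ _ cx)] := pr _ r0.
  rewrite /= pairingDl -pairingZl.
  suff -> : map_mx (GRing.scale r) phi%:M = (r *: phi)%:M :> 'M_n by [].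
  by apply/matrixP=> i j; rewrite !mxE scalerMnr.
Qed.

End Dual.

(** * Functionals dominated by a strictly positive one *)

Section DominatedFunctional.
Import numFieldNormedType.Exports.

Lemma mx_entry_le (R : realType) n (v : 'rV[R]_n) i : `|v 0 i| <= `|v|.
Proof.
rewrite [leRHS]/Num.norm /= mx_normrE.
by apply/bigmax_geP; right; exists (0, i).
Qed.

Variables (R : realType) (W : vectType R) (H : {vspace W}) (C : W -> Prop).
Variables (e : W).
Hypothesis CH : forall x, C x -> x \in H.
Hypothesis CD : forall x y, C x -> C y -> C (x + y).
Hypothesis CZ : forall (r : R) x, 0 <= r -> C x -> C (r *: x).
Hypothesis C_order : forall y, y \in H -> exists2 r : R, 0 < r & C (r *: e + y).
Hypothesis C_arch :
  forall y, y \in H -> (forall r : R, 0 < r -> C (r *: e + y)) -> C y.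

(** [T] parametrises H by coordinate vectors, so that the topological arguments take place on row
    vectors with the sup norm. *)
Let T (v : 'rV[R]_(\dim H)) : W := \sum_i v 0 i *: (vbasis H)`_i.

Let T_in v : T v \in H.
Proof.
apply: rpred_sum => i _.
by rewrite rpredZ // vbasis_mem // mem_nth // size_tuple.
Qed.

Let TD u v : T (u + v) = T u + T v.
Proof.
by rewrite /T -big_split; apply: eq_bigr => i _; rewrite mxE scalerDl.
Qed.

Let TZ a v : T (a *: v) = a *: T v.
Proof.
by rewrite /T scaler_sumr; apply: eq_bigr => i _; rewrite mxE scalerA.
Qed.

Let T_surj x : x \in H -> exists v, x = T v.
Proof.
move=> xH; exists (\row_i coord (vbasis H) i x).
by rewrite {1}(coord_vbasis xH); apply: eq_bigr => i _; rewrite mxE.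
Qed.

Let T_inj v : T v = 0 -> v = 0.
Proof.
move=> Tv0; apply/rowP=> i; rewrite mxE.
by have/freeP := basis_free (vbasisP H); apply.
Qed.

Let Ce (r : R) : 0 <= r -> C (r *: e).
Proof.
move=> r0; have [s s0] := C_order (mem0v H); rewrite addr0 => Cs.
have := CZ (divr_ge0 r0 (ltW s0)) Cs.
by rewrite scalerA divfK // gt_eqF.
Qed.

(** This says that e is interior to the cone relative to H, with a bound uniform in v. A multiple of
    e absorbs each basis vector and its negative, and the constants are added over the basis. *)
Lemma unit_interior :
  exists2 t : R, 0 < t &
    forall (v : 'rV[R]_(\dim H)) (s : R), 0 <= s ->
      (forall i, `|v 0 i| <= s) -> C ((t * s) *: e + T v).
Proof.
have basis (i : 'I_(\dim H)) : exists2 t : R, 0 < t &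
    forall a s : R, `|a| <= s -> C ((t * s) *: e + a *: (vbasis H)`_i).
  have bH : (vbasis H)`_(i : 'I_(\dim H)) \in H.
    by rewrite vbasis_mem // mem_nth // size_tuple.
  have bNH : - (vbasis H)`_i \in H by rewrite rpredN.
  have [t1 t10 C1] := C_order bH; have [t2 t20 C2] := C_order bNH.
  exists (t1 + t2) => [|a s]; first exact: addr_gt0.
  (* The element splits as a' (t e + x) plus a nonnegative multiple of e. The slack t' lets the same
     constant t1 + t2 serve both signs of a. *)
  have key (t t' a' : R) x : 0 <= a' -> a' <= s -> 0 < t -> 0 < t' ->
      C (t *: e + x) -> C (((t + t') * s) *: e + a' *: x).
    move=> a0 as_ t0 t'0 Cx.
    have -> : ((t + t') * s) *: e + a' *: x =
        a' *: (t *: e + x) + ((t + t') * s - a' * t) *: e.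
      rewrite scalerDr scalerA addrAC -scalerDl; congr (_ *: _ + _).
      by rewrite [RHS]addrC subrK.
    apply: CD; first exact: CZ.
    by apply: Ce; rewrite subr_ge0 mulrC ler_pM ?lerDl ?(ltW t0) ?(ltW t'0).
  case: (leP 0 a) => [a0|a0]; first by rewrite ger0_norm //; move=> /key; apply.
  rewrite ltr0_norm // => as_; rewrite -[a]opprK scaleNr -scalerN addrC.
  by rewrite [t1 + t2]addrC addrC; apply: key; rewrite // oppr_ge0 ltW.
have /boolp.choice[t tP] : forall i : 'I_(\dim H), exists t : R, 0 < t /\
    forall a s : R, `|a| <= s -> C ((t * s) *: e + a *: (vbasis H)`_i).
  by move=> i; have [t t0 Ct] := basis i; exists t.
(* The summand 1 keeps the constant positive even when H is zero. *)
exists (1 + \sum_i t i) => [|v s s0 vs].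
  by rewrite ltr_wpDr // sumr_ge0 // => i _; rewrite ltW //; case: (tP i).
rewrite mulrDl mul1r scalerDl -addrA mulr_suml scaler_suml -big_split /=.
apply: CD; first exact: Ce.
apply: (big_ind C) => [|x y|i _]; [|exact: CD|].
  by rewrite -(scale0r e); exact: Ce.
by case: (tP i) => _; apply.
Qed.

Local Open Scope classical_set_scope.

(** Near a limit point v there is a u in the cone within r / t of v. Then r e + T (v - u) is in C by
    [unit_interior], hence so is r e + T v, and the archimedean property lets r tend to 0. *)
Lemma cone_closed : closed [set v | C (T v)].
Proof.
move=> v clv; apply: C_arch => // r r0; have [t t0 Ct] := unit_interior.
have [u [/= Cu]] := clv _ (nbhsx_ballx v _ (divr_gt0 r0 t0)).
rewrite -ball_normE /ball_ /= => uv.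
have -> : T v = T (v - u) + T u by rewrite -TD subrK.
rewrite addrA; apply: CD => //.
have := Ct (v - u) (r / t); rewrite [t * _]mulrC divfK ?gt_eqF //; apply.
  by rewrite divr_ge0 ?ltW.
move=> i; apply: le_trans (ltW uv).
exact: mx_entry_le.
Qed.

(** The unit vectors of the cone form a compact set, on which p attains a positive minimum m and q
    is at least - M. Homogeneity extends the resulting inequality to the whole cone. *)
Lemma cone_dominated (p q : 'Hom(W, R^o)) :
  (forall x, C x -> x != 0 -> 0 < (p x : R)) ->
  exists2 r : R, 0 < r & forall x, C x -> 0 <= r * p x + q x.
Proof.
move=> p_gt0.
pose K0 := [set v | C (T v)] `&` [set v : 'rV[R]_(\dim H) | `|v| = 1].
have compK0 : compact K0.
  apply: bounded_closed_compact.
    by exists 1; split=> // x x1 v /= [_ ->]; exact: ltW.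
  apply: closedI; first exact: cone_closed.
  apply: (@preimage_closed _ _
    (fun v : 'rV[R]_(\dim H) => `|v|) [set x : R | x = 1]).
    by move=> v _; exact: norm_continuous.
  exact: closed_eq.
have cont_p : continuous (fun v : 'rV[R]_(\dim H) => p (T v) : R).
  have -> : (fun v => p (T v) : R) =
      (fun v => \sum_i (v 0 i * (p (vbasis H)`_i : R))).
    apply/funext=> v; rewrite linear_sum; apply: eq_bigr => i _.
    by rewrite linearZ.
  apply: continuous_big => [|i _ v]; first exact: add_continuous.
  apply: (@continuousM R _ (fun v : 'rV[R]_(\dim H) => v 0 i) (fun=> _)).
    exact: coord_continuous.
  exact: cst_continuous.
pose M := \sum_(i < \dim H) `|(q (vbasis H)`_i : R)|.
have M0 : 0 <= M by apply: sumr_ge0.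
have qM v : `|v| = 1 -> - M <= q (T v).
  move=> v1; rewrite lerNl (le_trans (ler_norm _)) // normrN linear_sum.
  apply: (le_trans (ler_norm_sum _ _ _)); apply: ler_sum => i _.
  rewrite linearZ normrM ler_piMl // (le_trans (mx_entry_le _ _)) //.
  by rewrite v1.
have normalize x : C x -> x != 0 ->
    exists v, exists2 s : R, 0 < s & x = s *: T v /\ K0 v.
  move=> Cx x0; have [u xu] := T_surj (CH Cx).
  have u0 : 0 < `|u|.
    rewrite normr_gt0; apply: contraNneq x0 => u0; rewrite xu u0.
    by rewrite /T big1 // => i _; rewrite mxE scale0r.
  exists (`|u|^-1 *: u), `|u| => //; split.
    by rewrite TZ scalerA divff ?gt_eqF // scale1r.
  split=> /=; last by rewrite normrZ gtr0_norm ?invr_gt0 // mulVf ?gt_eqF.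
  by rewrite TZ -xu; apply: CZ; rewrite // invr_ge0 ltW.
(* If there is no unit vector in the cone, then C contains at most 0 and any r works. *)
have [K0e|] := pselect (K0 !=set0); last first.
  move=> K0e; exists 1 => // x Cx; have [->|x0] := eqVneq x 0.
    by rewrite !linear0 mulr0 addr0.
  by have [v [s _ [_ K0v]]] := normalize _ Cx x0; case: K0e; exists v.
have [c] := compact_EVT_min K0e compK0 (continuous_subspaceT cont_p).
rewrite inE => -[/= Cc c1] c_min.
have m0 : 0 < (p (T c) : R).
  apply: p_gt0 => //; apply/eqP=> /T_inj c0.
  by move/eqP: c1; rewrite c0 normr0 eq_sym oner_eq0.
set m : R := p (T c) in m0 c_min.
(* On unit vectors r p + q is then at least (M / m + 1) m - M = m. The summand 1 makes r positive
   also when M = 0. *)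
exists (M / m + 1) => [|x Cx]; first by rewrite ltr_wpDl // divr_ge0 // ltW.
have [->|x0] := eqVneq x 0; first by rewrite !linear0 mulr0 addr0.
have [v [s s0 [-> K0v]]] := normalize _ Cx x0.
rewrite !linearZ /GRing.scale /= mulrCA -mulrDr pmulr_rge0 //.
have pv : m <= p (T v) by apply: c_min; rewrite inE.
case: K0v => _ /qM qv; rewrite -[q _]opprK subr_ge0.
apply: (@le_trans _ _ ((M / m + 1) * m)); last first.
  rewrite ler_wpM2l //; by rewrite addr_ge0 // divr_ge0 // ltW.
rewrite mulrDl divfK ?gt_eqF // mul1r; apply: ler_wpDr; first exact: ltW.
by rewrite lerNl.
Qed.

End DominatedFunctional.

(** * The dual of a real operator system *)

Lemma lfun_linearE (K : fieldType) (V W : vectType K) (f : V -> W) :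
  linear f -> linfun f =1 f.
Proof.
move=> lin_f x; pose fl := GRing.isLinear.Build _ _ _ _ f lin_f.
pose F : {linear V -> W} := HB.pack f fl.
exact: (lfunE F x).
Qed.

Section RealDual.
Variables (R : realType) (V : vectType R) (S : opsys_data V).
Variable phi : 'Hom(V, R^o).
Hypothesis sysS : operator_system idfun S.
Hypothesis state_phi : faithful_state S phi.

Lemma cone_diag n (x : 'M[V]_n) i : os_cone S x -> @os_cone _ _ S 1 (x i i)%:M.
Proof.
move=> cx; have := cone_reindex sysS (fun _ : 'I_1 => i) (fun=> 1) cx.
congr os_cone; apply/matrixP=> p q.
by rewrite !ord1 !mxE mulr1 scale1r mulr1n.
Qed.

(* Compressing by diag(1, -1) negates the off-diagonal part of a 2 x 2
   positive matrix, so properness forbids a zero diagonal. *)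
Lemma cone_diag_eq0 n (x : 'M[V]_n) :
  os_cone S x -> (forall i, x i i = 0) -> x = 0.
Proof.
move=> cx x0; apply/matrixP=> i j; rewrite mxE.
have [->|ij] := eqVneq i j; first exact: x0.
pose h (k : 'I_2) := if k == ord0 then i else j.
pose s (k : 'I_2) : R := if k == ord0 then 1 else -1.
pose y : 'M[V]_2 := \matrix_(k, l) x (h k) (h l).
have cy : os_cone S y.
  have := cone_reindex sysS h (fun=> 1) cx; congr os_cone.
  by apply/matrixP=> k l; rewrite !mxE mulr1 scale1r.
have cNy : os_cone S (- y).
  have := cone_reindex sysS id s cy; congr os_cone.
  apply/matrixP=> k l; rewrite !mxE /h /s.
  by case: eqP => _; case: eqP => _;
     rewrite /= ?x0 ?scaler0 ?oppr0 ?mulN1r ?mulrN1 ?scaleN1r ?scale1r.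
have /matrixP/(_ ord0 (lift ord0 ord0)) := cone_proper sysS cy cNy.
by rewrite !mxE.
Qed.

(** A sum of nonnegative terms phi(x_ii) vanishes only if each does. Faithfulness of [phi] then
    kills the diagonal of x, and [cone_diag_eq0] kills the rest. *)
Lemma trace_faithful n (x : 'M[V]_n) :
  os_cone S x -> x != 0 -> 0 < pairing phi%:M x.
Proof.
move=> cx; apply: contraNT; rewrite pairing_scalar => tr_le0.
have phi_ge0 i : 0 <= (phi (x i i) : R).
  by apply: (state_positive state_phi); exact: cone_diag.
have /eqP : \sum_i (phi (x i i) : R) = 0.
  by apply/eqP; rewrite eq_le leNgt tr_le0 sumr_ge0.
rewrite psumr_eq0 // => /allP tr0; apply/eqP/cone_diag_eq0 => // i.
apply: (state_faithful state_phi); first exact: cone_diag.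
by apply/eqP/tr0; rewrite mem_index_enum.
Qed.

Lemma trace_dominates n (psi : 'M['Hom(V, R^o)]_n) :
  exists2 r : R, 0 < r &
    forall x, os_cone S x -> 0 <= pairing ((r *: phi)%:M + psi) x.
Proof.
(* Matrices over V are recoded as finite functions, which form a [vectType] to which
   [cone_dominated] applies. *)
pose W : vectType R := {ffun 'I_n * 'I_n -> V}.
pose mx (w : W) : 'M[V]_n := \matrix_(i, j) w (i, j).
have mxD w w' : mx (w + w') = mx w + mx w'.
  by apply/matrixP=> i j; rewrite !mxE ffunE.
have mxZ a w : mx (a *: w) = map_mx (GRing.scale a) (mx w).
  by apply/matrixP=> i j; rewrite !mxE ffunE.
pose st (w : W) : W := [ffun ij => os_star S (w (ij.2, ij.1))].
have st_lin : linear st.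
  by move=> a w w'; apply/ffunP=> ij; rewrite !ffunE (star_linear sysS).
(* Over the reals the involution is linear, so the selfadjoint matrices form a subspace. The order
   unit and archimedean axioms concern exactly these. *)
pose H := fixedSpace (linfun st).
have HP w : reflect (mx_star (os_star S) (mx w) = mx w) (w \in H).
  have -> : (w \in H) = (st w == w).
    by apply/fixedSpaceP/eqP; rewrite (lfun_linearE st_lin).
  apply: (iffP eqP) => [wH|/matrixP wH].
    by apply/matrixP=> i j; rewrite -[in RHS]wH !mxE ffunE.
  by apply/ffunP=> -[i j]; rewrite ffunE; have := wH i j; rewrite !mxE.
pose e : W := [ffun ij => os_unit S *+ (ij.1 == ij.2)].
have mxe (r : R) : mx (r *: e) = (r *: os_unit S)%:M.
  by apply/matrixP=> i j; rewrite !mxE !ffunE scalerMnr.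
have mx_pair (chi : 'M['Hom(V, R^o)]_n) :
    linear (fun w => pairing chi (mx w) : R^o).
  move=> a w w'; rewrite mxD pairingDr mxZ; congr (_ + _).
  rewrite /pairing scaler_sumr; apply: eq_bigr => i _; rewrite scaler_sumr.
  by apply: eq_bigr => j _; rewrite mxE linearZ.
pose p : 'Hom(W, R^o) := linfun (fun w => pairing phi%:M (mx w) : R^o).
pose q : 'Hom(W, R^o) := linfun (fun w => pairing psi (mx w) : R^o).
have [w|w w'|r w|w|w|w|r r0 dom] :=
  @cone_dominated R W H (fun w => os_cone S (mx w)) e _ _ _ _ _ p q _.
- by move/(cone_star sysS)/HP.
- by rewrite mxD; exact: (cone_add sysS).
- by rewrite mxZ; exact: (cone_scale sysS).
- move/HP/(unit_order sysS) => [r r0 cw]; exists r => //.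
  by rewrite mxD mxe.
- move/HP=> saw pos; apply: (unit_archimedean sysS saw) => r r0.
  by have := pos r r0; rewrite mxD mxe.
- move=> cw w0; rewrite (lfun_linearE (mx_pair _)) trace_faithful //.
  apply: contraNneq w0 => /matrixP mxw0; apply/eqP/ffunP=> -[i j].
  by have := mxw0 i j; rewrite !mxE ffunE.
exists r => // x cx.
pose w : W := [ffun ij => x ij.1 ij.2].
have mxw : mx w = x by apply/matrixP=> i j; rewrite !mxE ffunE.
have := dom w; rewrite !(lfun_linearE (mx_pair _)) mxw => /(_ cx).
rewrite pairingDl -pairingZl.
suff -> : map_mx (GRing.scale r) phi%:M = (r *: phi)%:M :> 'M_n by [].
by apply/matrixP=> i j; rewrite !mxE scalerMnr.
Qed.

Lemma real_dual_operator_system :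
  operator_system idfun (dual_opsys idfun S phi).
Proof.
apply: dual_operator_system => //.
- exact: state_selfadjoint state_phi.
- exact: state_positive state_phi.
- by move=> n psi _; exact: trace_dominates.
Qed.

End RealDual.

(** * Complexification *)

Section CplxMatrix.
Variables (R : realType) (V : vectType R).

Lemma cplx_ext (z w : cplx V) : cre z = cre w -> cim z = cim w -> z = w.
Proof. by case: z w => [x y] [u v] /= -> ->. Qed.

Lemma cre_sum I (r : seq I) P (F : I -> cplx V) :
  cre (\sum_(i <- r | P i) F i) = \sum_(i <- r | P i) cre (F i).
Proof. exact: (big_morph (@cre V)). Qed.

Lemma cim_sum I (r : seq I) P (F : I -> cplx V) :
  cim (\sum_(i <- r | P i) F i) = \sum_(i <- r | P i) cim (F i).
Proof. exact: (big_morph (@cim V)). Qed.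

(** This is the matrix tested by the cone of [cplx_opsys]. Since [realify] is injective and commutes
    with sums, real scaling, compression and the involution, each axiom of the complexification at
    size n is read off from size 2n. *)
Definition realify n (z : 'M[cplx V]_n) : 'M[V]_(n + n) :=
  let x := map_mx (@cre V) z in let y := map_mx (@cim V) z in
  block_mx x (- y) y x.

Definition realify_scalar n m (A : 'M[R[i]]_(n, m)) : 'M[R]_(n + n, m + m) :=
  let x := map_mx (@complex.Re R) A in let y := map_mx (@complex.Im R) A in
  block_mx x (- y) y x.

Lemma realifyD n (z w : 'M[cplx V]_n) :
  realify (z + w) = realify z + realify w.
Proof.
rewrite /realify add_block_mx -opprD.
by congr block_mx; try congr (- _); apply/matrixP=> i j; rewrite !mxE.
Qed.

Lemma realifyN n (z : 'M[cplx V]_n) : realify (- z) = - realify z.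
Proof.
rewrite /realify opp_block_mx.
by congr block_mx; try congr (- _); apply/matrixP=> i j; rewrite !mxE.
Qed.

Lemma realifyZ n (r : R) (z : 'M[cplx V]_n) :
  realify (map_mx (GRing.scale r%:C%C) z) = map_mx (GRing.scale r) (realify z).
Proof.
rewrite /realify map_block_mx.
by congr block_mx; apply/matrixP=> i j;
   rewrite !mxE /= scale0r ?subr0 ?addr0 ?scalerN.
Qed.

Lemma realify_inj n : injective (@realify n).
Proof.
move=> z w /eq_block_mx[/matrixP re _ /matrixP im _]; apply/matrixP=> i j.
by have := re i j; have := im i j; rewrite !mxE => ? ?; apply: cplx_ext.
Qed.

Lemma realify_scalar_mx n (x : V) :
  realify ((Cplx x 0)%:M : 'M_n) = x%:M.
Proof.
rewrite /realify (scalar_mx_block n n).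
congr block_mx; apply/matrixP=> i j; rewrite !mxE; case: (i == j);
  by rewrite ?mulr1n ?mulr0n ?oppr0.
Qed.

(** Realification turns the conjugate transpose of a scalar matrix into the plain transpose, so
    [conjc] on the left becomes [idfun] on the right. *)
Lemma realify_compress n m (A : 'M[R[i]]_(n, m)) (z : 'M[cplx V]_n) :
  realify (mx_compress (@conjc R) A z) =
  mx_compress idfun (realify_scalar A) (realify z).
Proof.
apply/matrixP=> i j; rewrite [RHS]mxE big_split_ord /= -big_split /=.
under [RHS]eq_bigr => k _ do
  rewrite !big_split_ord /= -!big_split /=.
have blockE := (block_mxEul, block_mxEur, block_mxEdl, block_mxEdr).
(* V is only a module, so the entries are compared coordinate by coordinate through [v2r], where
   [ring] applies. *)
by rewrite /realify /realify_scalar;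
   case: (split_ordP i) => i' ->; case: (split_ordP j) => j' ->;
   rewrite !blockE !mxE ?cre_sum ?cim_sum -?sumrN; apply: eq_bigr => k _;
   rewrite ?cre_sum ?cim_sum -?sumrN; apply: eq_bigr => l _;
   rewrite !blockE !mxE; case: (A k i') => a a'; case: (A l j') => b b';
   case: (z k l) => x y; rewrite /=; apply: (can_inj v2rK); apply/rowP=> d;
   rewrite ?linearE ?linearN /= ?mxE ?linearN ?mxE; ring.
Qed.

End CplxMatrix.

Lemma conjc_ge0 (R : realType) (r : R[i]) : 0 <= r -> conjc r = r.
Proof.
by case: r => a b; rewrite lecE /= => /andP[/eqP -> _]; rewrite oppr0.
Qed.

Lemma complex_ge0E (R : realType) (r : R[i]) :
  0 <= r -> r = (complex.Re r)%:C%C.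
Proof. by case: r => a b; rewrite lecE /= => /andP[/eqP -> _]. Qed.

Section CplxOpsys.
Variables (R : realType) (V : vectType R) (S : opsys_data V).
Hypothesis sysS : operator_system idfun S.

Let starD := os_starD sysS.
Let starZ := os_starZ sysS.

Lemma os_starN x : os_star S (- x) = - os_star S x.
Proof. by rewrite -scaleN1r starZ scaleN1r. Qed.

Lemma realify_star n (z : 'M[cplx V]_n) :
  realify (mx_star (cplx_star (os_star S)) z) =
  mx_star (os_star S) (realify z).
Proof.
rewrite /realify /mx_star tr_block_mx map_block_mx.
by congr block_mx; apply/matrixP=> i j; rewrite !mxE //= ?opprK ?os_starN.
Qed.

(** A positive [realify z] is selfadjoint; pulled back along the injective [realify], this yields
    the conditions x = x^* and y = - y^*. *)
Lemma cplx_coneP n (z : 'M[cplx V]_n) :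
  os_cone (cplx_opsys S) z <-> os_cone S (realify z).
Proof.
split=> [[]//|cz]; have := cone_star sysS cz; rewrite -realify_star.
move=> /realify_inj /matrixP sa; split=> //; apply/matrixP=> i j;
  by rewrite !mxE -[in LHS]sa !mxE /=.
Qed.

Lemma realify_unit_add n (r : R) (z : 'M[cplx V]_n) :
  realify ((r%:C%C *: os_unit (cplx_opsys S))%:M + z) =
  (r *: os_unit S)%:M + realify z.
Proof.
rewrite realifyD -realify_scalar_mx; congr (realify _%:M + _).
by apply: cplx_ext; rewrite /= ?scale0r ?scaler0 ?subr0 ?addr0.
Qed.

Lemma realify_selfadjoint n (z : 'M[cplx V]_n) :
  mx_star (os_star (cplx_opsys S)) z = z <->
  mx_star (os_star S) (realify z) = realify z.
Proof.
rewrite -realify_star; split=> [{2}<- //|]; exact: realify_inj.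
Qed.

(** It is applied both to S and to the real dual of S; the second use provides the order unit of the
    complex dual. *)
Lemma cplx_operator_system : operator_system (@conjc R) (cplx_opsys S).
Proof.
split.
- move=> [a a'] [x y] [u v]; apply: cplx_ext;
    rewrite /= !(starD, os_starN, starZ) /=.
    by rewrite scaleNr scalerN opprK.
  by rewrite !opprD scalerN scaleNr.
- by move=> [x y]; apply: cplx_ext;
    rewrite /= ?os_starN ?opprK (star_invol sysS).
- by move=> n z /cplx_coneP cz; apply/realify_selfadjoint/(cone_star sysS).
- move=> n z w /cplx_coneP cz /cplx_coneP cw; apply/cplx_coneP.
  by rewrite realifyD; exact: (cone_add sysS).
- move=> n r z r0 /cplx_coneP cz; apply/cplx_coneP.
  rewrite (complex_ge0E r0) realifyZ.
  by apply: (cone_scale sysS) => //; move: r0; rewrite lecE => /andP[].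
- move=> n m A z /cplx_coneP cz; apply/cplx_coneP; rewrite realify_compress.
  exact: (cone_compress sysS).
- move=> n z /cplx_coneP cz /cplx_coneP; rewrite realifyN.
  move=> /(cone_proper sysS cz) z0; apply: realify_inj; rewrite z0.
  by apply: (addrI (realify 0)); rewrite -realifyD !addr0.
- by apply: cplx_ext;
    rewrite /= ?(unit_star sysS) ?(os_star0 sysS) ?oppr0.
- move=> n z /realify_selfadjoint/(unit_order sysS) [r r0 cz].
  exists r%:C%C; first by rewrite ltcE /= eqxx.
  by apply/cplx_coneP; rewrite realify_unit_add.
- move=> n z /realify_selfadjoint saz pos; apply/cplx_coneP.
  apply: (unit_archimedean sysS saz) => r r0.
  have /pos/cplx_coneP : 0 < r%:C%C :> R[i] by rewrite ltcE /= eqxx.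
  by rewrite realify_unit_add.
Qed.

End CplxOpsys.

(** * Complex functionals as pairs of real functionals *)

Section Iso.
Variables (R : realType) (V : vectType R).
Local Notation V_c := (cplx V).

(** By complex linearity psi(x + i y) = psi(x) + i psi(y), so the restriction of [psi] to V carries
    all of it. *)
Definition split_functional (psi : 'Hom(V_c, R[i]^o)) : cplx 'Hom(V, R^o) :=
  Cplx (linfun (fun x => complex.Re (psi (Cplx x 0)) : R^o))
       (linfun (fun x => complex.Im (psi (Cplx x 0)) : R^o)).

Definition join_functional (w : cplx 'Hom(V, R^o)) : 'Hom(V_c, R[i]^o) :=
  cplx_functional (cre w) + 'i%C *: cplx_functional (cim w).

Lemma cplx_embed_linear (a : R) (x y : V) :
  Cplx (a *: x + y) 0 = a%:C%C *: Cplx x 0 + Cplx y 0 :> V_c.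
Proof.
by apply: cplx_ext; rewrite /= ?scale0r ?scaler0 ?subr0 ?addr0.
Qed.

Lemma split_functional_reE psi x :
  cre (split_functional psi) x = complex.Re (psi (Cplx x 0)).
Proof.
apply: lfun_linearE => a u v; rewrite cplx_embed_linear linearD linearZ.
by rewrite /=; case: (psi _) (psi _) => [b b'] [c c'];
  rewrite /GRing.scale /= mul0r subr0.
Qed.

Lemma split_functional_imE psi x :
  cim (split_functional psi) x = complex.Im (psi (Cplx x 0)).
Proof.
apply: lfun_linearE => a u v; rewrite cplx_embed_linear linearD linearZ.
by rewrite /=; case: (psi _) (psi _) => [b b'] [c c'];
  rewrite /GRing.scale /= mul0r addr0.
Qed.

Lemma cplx_decomp (x y : V) : Cplx x y = Cplx x 0 + 'i%C *: Cplx y 0.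
Proof.
by apply: cplx_ext;
   rewrite /= ?scale0r ?scaler0 ?scale1r ?subr0 ?addr0 ?add0r.
Qed.

Lemma functional_cplxE (psi : 'Hom(V_c, R[i]^o)) x y :
  psi (Cplx x y) =
  Complex (cre (split_functional psi) x - cim (split_functional psi) y)
          (cim (split_functional psi) x + cre (split_functional psi) y).
Proof.
rewrite cplx_decomp linearD linearZ !split_functional_reE !split_functional_imE.
rewrite /=; case: (psi _) (psi _) => [a a'] [b b'].
by rewrite /GRing.scale /=; simpc.
Qed.

Lemma join_functionalE w x y :
  join_functional w (Cplx x y) =
  Complex (cre w x - cim w y) (cim w x + cre w y).
Proof.
rewrite add_lfunE scale_lfunE !cplx_functionalE /= /GRing.scale /=; simpc.
by rewrite [X in Complex _ X]addrC.
Qed.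

Lemma join_functionalK : cancel join_functional split_functional.
Proof.
move=> w; apply: cplx_ext; apply/lfunP=> x.
  by rewrite split_functional_reE join_functionalE /= linear0 subr0.
by rewrite split_functional_imE join_functionalE /= linear0 addr0.
Qed.

Lemma split_functionalK : cancel split_functional join_functional.
Proof.
by move=> psi; apply/lfunP=> -[x y]; rewrite join_functionalE -functional_cplxE.
Qed.

Lemma join_functional_linear : linear join_functional.
Proof.
move=> [a a'] [f g] [h k]; apply/lfunP=> -[x y].
rewrite join_functionalE [RHS]add_lfunE scale_lfunE !join_functionalE /=.
rewrite !(add_lfunE, opp_lfunE, scale_lfunE) /GRing.scale /=; simpc.
by congr Complex; ring.
Qed.

Lemma split_functional_linear : linear split_functional.
Proof.
move=> a psi chi; apply: (can_inj join_functionalK).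
by rewrite join_functional_linear !split_functionalK.
Qed.

End Iso.

(** * Comparison of the two duals *)

Section Correspondence.
Variables (R : realType) (V : vectType R) (S : opsys_data V).
Variable phi : 'Hom(V, R^o).
Hypothesis sysS : operator_system idfun S.
Hypothesis state_phi : faithful_state S phi.

Local Notation S_c := (cplx_opsys S).
Local Notation S_d := (dual_opsys idfun S phi).
Local Notation S_cd := (dual_opsys (@conjc R) S_c (cplx_functional phi)).

Let sysSd : operator_system idfun S_d :=
  real_dual_operator_system sysS state_phi.
Let sysSc : operator_system (@conjc R) S_c := cplx_operator_system sysS.

Lemma Re_sum I (r : seq I) P (F : I -> R[i]) :
  complex.Re (\sum_(i <- r | P i) F i) = \sum_(i <- r | P i) complex.Re (F i).
Proof. by apply: (big_morph (@complex.Re R)) => // -[a a'] [b b']. Qed.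

(** This map is adjoint to [realify] under the real part of the pairing. With psi = f + i g and x =
    [[a, b], [c, d]], the realified pairing is f(a) - g(b) + g(c) + f(d) = f(a + d) - g(b - c). *)
Definition complexify_blocks n (x : 'M[V]_(n + n)) : 'M[cplx V]_n :=
  \matrix_(i, j) Cplx (ulsubmx x i j + drsubmx x i j)
                      (ursubmx x i j - dlsubmx x i j).

Lemma pairing_realify n (psi : 'M['Hom(cplx V, R[i]^o)]_n)
    (x : 'M[V]_(n + n)) :
  pairing (realify (map_mx (@split_functional R V) psi)) x =
  complex.Re (pairing psi (complexify_blocks x)).
Proof.
rewrite /pairing Re_sum big_split_ord /= -big_split; apply: eq_bigr => i _ /=.
rewrite Re_sum !big_split_ord /= -!big_split; apply: eq_bigr => j _ /=.
rewrite /realify !(block_mxEul, block_mxEur, block_mxEdl, block_mxEdr).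
rewrite !mxE functional_cplxE /= opp_lfunE !linearD !linearN /=.
by ring.
Qed.

Definition block_sign n (i : 'I_(n + n)) : R :=
  if split i is inl _ then 1 else -1.

Definition block_swap n (i : 'I_(n + n)) : 'I_(n + n) :=
  match split i with inl k => rshift n k | inr k => lshift n k end.

Lemma split_lshift n (i : 'I_n) : split (lshift n i) = inl i.
Proof. exact: (unsplitK (inl i)). Qed.

Lemma split_rshift n (i : 'I_n) : split (rshift n i) = inr i.
Proof. exact: (unsplitK (inr i)). Qed.

(** For x = [[a, b], [c, d]] the realification of the image is [[a, -b], [-c, d]] + [[d, c],
    [b, a]]. The first summand is x compressed by diag(1, -1), the second is x compressed by the
    block swap. *)
Lemma cone_complexify_blocks n (x : 'M[V]_(n + n)) :
  os_cone S x -> os_cone S_c (complexify_blocks x).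
Proof.
move=> cx; apply/(cplx_coneP sysS).
have := cone_add sysS (cone_reindex sysS id (@block_sign n) cx)
  (cone_reindex sysS (@block_swap n) (fun=> 1) cx).
congr os_cone; apply/matrixP=> i j; rewrite /realify.
by case: (split_ordP i) => i' ->; case: (split_ordP j) => j' ->;
   rewrite !(block_mxEul, block_mxEur, block_mxEdl, block_mxEdr) !mxE
     /block_sign /block_swap !(split_lshift, split_rshift)
     ?mulr1 ?mul1r ?mulrNN ?mulr1 ?scale1r ?scaleN1r ?opprB // addrC.
Qed.

Lemma complexify_blocks_realify n (z : 'M[cplx V]_n) :
  os_cone S_c z ->
  exists2 x, os_cone S x & complexify_blocks x = z + z.
Proof.
move=> /(cplx_coneP sysS) cz.
move: {-2}(realify z) (erefl (realify z)) cz => w wE cw.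
(* Applied to [[x, -y], [y, x]] directly, [complexify_blocks] would give 2 (x - i y). The signs pass
   to [[x, y], [-y, x]], whose image is 2 (x + i y). *)
exists (\matrix_(i, j) ((block_sign i * block_sign j) *: w i j)).
  exact: (cone_reindex sysS id (@block_sign n) cw).
apply/matrixP=> i j; rewrite !mxE /block_sign !(split_lshift, split_rshift) wE.
rewrite /realify !(block_mxEul, block_mxEur, block_mxEdl, block_mxEdr) !mxE.
by apply: cplx_ext;
   rewrite /= ?mulr1 ?mul1r ?mulrNN ?mulr1 ?scale1r ?scaleN1r ?opprK.
Qed.

Lemma split_functional_unit :
  split_functional (cplx_functional phi) = os_unit (cplx_opsys S_d).
Proof.
apply: cplx_ext; apply/lfunP=> x /=.
  by rewrite split_functional_reE cplx_functionalE.
by rewrite split_functional_imE cplx_functionalE /= linear0 zero_lfunE.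
Qed.

Lemma split_functional_star (psi : 'Hom(cplx V, R[i]^o)) :
  split_functional (dual_star (@conjc R) S_c psi) =
  os_star (cplx_opsys S_d) (split_functional psi).
Proof.
apply: cplx_ext; apply/lfunP=> x /=.
  rewrite split_functional_reE (dual_starP (@conjcK R) sysSc).
  rewrite (dual_starP _ sysS) // split_functional_reE /= /cplx_star /=.
  by rewrite (os_star0 sysS) oppr0; case: (psi _).
rewrite split_functional_imE opp_lfunE (dual_starP (@conjcK R) sysSc).
rewrite (dual_starP _ sysS) // split_functional_imE /= /cplx_star /=.
by rewrite (os_star0 sysS) oppr0; case: (psi _).
Qed.

Lemma split_functional_selfadjoint n (psi : 'M['Hom(cplx V, R[i]^o)]_n) :
  mx_star (dual_star (@conjc R) S_c) psi = psi <->
  mx_star (os_star (cplx_opsys S_d)) (map_mx (@split_functional R V) psi) =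
    map_mx (@split_functional R V) psi.
Proof.
split=> /matrixP sa; apply/matrixP=> i j; have := sa i j; rewrite !mxE.
  by rewrite -split_functional_star => ->.
by rewrite -split_functional_star => /(can_inj (@split_functionalK R V)).
Qed.

Lemma split_functional_coneP n (psi : 'M['Hom(cplx V, R[i]^o)]_n) :
  os_cone S_cd psi <->
  os_cone (cplx_opsys S_d) (map_mx (@split_functional R V) psi).
Proof.
split.
  move=> /(dual_coneP (@conjcK R) sysSc) [sa pos].
  apply/(cplx_coneP sysSd)/(dual_coneP _ sysS) => //; split=> [|x cx].
    exact/(realify_selfadjoint sysSd)/split_functional_selfadjoint.
  rewrite pairing_realify.
  by have := pos _ (cone_complexify_blocks cx); rewrite lecE => /andP[].
move=> /(cplx_coneP sysSd)/(dual_coneP _ sysS) [//|sa pos].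
have {}sa : mx_star (dual_star (@conjc R) S_c) psi = psi.
  exact/split_functional_selfadjoint/(realify_selfadjoint sysSd).
apply/(dual_coneP (@conjcK R) sysSc); split=> // z cz.
have [x cx xz] := complexify_blocks_realify cz.
(* The real hypothesis bounds only the real part of the pairing with 2 z. The imaginary part
   vanishes because [psi] and z are selfadjoint. *)
have := pos x cx; rewrite pairing_realify xz pairingDr.
have := cj_pairing (@conjcK R) sysSc psi z.
rewrite sa (cone_star sysSc cz); case: (pairing psi z) => a b [] /=.
move/eqP; rewrite eq_sym -addr_eq0 -mulr2n mulrn_eq0 /= => /eqP -> {b}.
by rewrite -mulr2n pmulrn_lge0 // lecE /= eqxx.
Qed.

Lemma complex_dual_operator_system : operator_system (@conjc R) S_cd.
Proof.
apply: (dual_operator_system (@conjcK R) (@conjc_ge0 R) sysSc).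
- move=> [x y]; rewrite !cplx_functionalE /= linearN /=.
  by rewrite !(state_selfadjoint state_phi) opprK.
- move=> [x y] cz; rewrite cplx_functionalE lecE /=.
  (* At size 1 the cone gives y = - y^*, hence phi(y) = - phi(y) = 0, while x is a diagonal entry of
     the positive realification. *)
  have [_ /matrixP/(_ 0 0) + _] := cz; rewrite !mxE eqxx !mulr1n /= => y_anti.
  move/(cplx_coneP sysS)/(cone_diag sysS (lshift 1 (0 : 'I_1))) : cz.
  rewrite /realify block_mxEul !mxE eqxx mulr1n /=.
  move/(state_positive state_phi) ->; rewrite andbT.
  have := congr1 phi y_anti; rewrite linearN /= (state_selfadjoint state_phi).
  by move/eqP; rewrite -addr_eq0 -mulr2n mulrn_eq0.
(* The dominating multiple of the unit is found in the complexified real dual and carried back along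
   the agreement of the cones. *)
- move=> n psi /split_functional_selfadjoint.
  move/(unit_order (cplx_operator_system sysSd)) => [r r0 c_psi].
  exists r => //; suff /split_functional_coneP : os_cone (cplx_opsys S_d)
    (map_mx (@split_functional R V) ((r *: cplx_functional phi)%:M + psi)).
    by case/(dual_coneP (@conjcK R) sysSc).
  move: c_psi; congr os_cone; apply/matrixP=> i j; rewrite !mxE.
  rewrite -split_functional_unit.
  have sD := split_functional_linear (V := V).
  rewrite -[X in split_functional (X + _)]scale1r sD scale1r; congr (_ + _).
  have s0 : split_functional (0 : 'Hom(cplx V, R[i]^o)) = 0.
    by rewrite -[0 in LHS](addNr 0) -scaleN1r sD scaleN1r addNr.
  case: (i == j); rewrite ?mulr0n ?s0 // !mulr1n.
  by rewrite -[_ *: cplx_functional _]addr0 sD s0 addr0.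
Qed.

Lemma complexified_dual_iso :
  unital_complete_order_iso S_cd (cplx_opsys S_d).
Proof.
have fE := lfun_linearE (@split_functional_linear R V).
have gE := lfun_linearE (@join_functional_linear R V).
exists (linfun (@split_functional R V)), (linfun (@join_functional R V)).
split=> [psi|w||n psi c_psi|n w cw].
- by rewrite fE gE split_functionalK.
- by rewrite gE fE join_functionalK.
- by rewrite fE split_functional_unit.
- have -> : map_mx (linfun (@split_functional R V)) psi =
      map_mx (@split_functional R V) psi.
    by apply/matrixP=> i j; rewrite !mxE fE.
  exact/split_functional_coneP.
apply/split_functional_coneP.
suff -> : map_mx (@split_functional R V)
    (map_mx (linfun (@join_functional R V)) w) = w by [].
by apply/matrixP=> i j; rewrite !mxE gE join_functionalK.
Qed.

End Correspondence.

Theorem theorem8p1 (R : realType) (V : vectType R) (S : opsys_data V)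
    (phi : 'Hom(V, R^o)) :
  real_operator_system S ->
  faithful_state S phi ->
  [/\ real_operator_system (dual_opsys idfun S phi),
      complex_operator_system
        (dual_opsys (@conjc R) (cplx_opsys S) (cplx_functional phi))
    & unital_complete_order_iso
        (dual_opsys (@conjc R) (cplx_opsys S) (cplx_functional phi))
        (cplx_opsys (dual_opsys idfun S phi))].
Proof.
move=> sysS state_phi; split.
- exact: real_dual_operator_system.
- exact: complex_dual_operator_system.
exact: complexified_dual_iso.
Qed.
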